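(* Let $\mathcal{T}=(V,E)$ be a countably infinite rooted and leafless directed tree, and let $\boldsymbol{\beta}=\{\beta_v\}_{v\in V}\subseteq(0,\infty)$ and $\boldsymbol{\lambda}=\{\lambda_v\}_{v\in V^\circ}\subseteq(0,\infty)$ satisfy $\sup_{u\in V}\sum_{v\in\mathrm{Chi}(u)}|\lambda_v|^2\frac{\beta_v}{\beta_u}<\infty$ and $\sum_{v\in\mathrm{Chi}(u)}\lambda_v=1$ for every $u\in V$. Let $S_{\boldsymbol\lambda}$ be the weighted shift on $\mathcal{T}_{\boldsymbol\beta}$. If the directed tree $\mathcal{T}$ has finitely many branching vertices, then $$\sigma_p(S_{\boldsymbol\lambda}^* )\subseteq\{z\in\mathbb{C}:|z|\le r_2^+(S_{\boldsymbol\lambda})\}.$$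
   Context: $\mathbb{N}_0=\{0,1,2,\dots\}$; $\sigma_p(A)$ is the point spectrum of $A$. A rooted directed tree $\mathcal{T}=(V,E)$ is a connected directed graph without circuits having a unique vertex $\mathrm{root}$ without a parent and such that every $v\in V^\circ:=V\setminus\{\mathrm{root}\}$ has a unique parent $\mathrm{par}(v)$, i.e. a unique $u$ with $(u,v)\in E$. $\mathrm{par}^k$ is the $k$-fold composition of $\mathrm{par}$ ($\mathrm{par}^0$ the identity); $\mathrm{Chi}(u)=\{v\in V:(u,v)\in E\}$; leafless means every vertex has at least one child; a vertex $v$ is a branching vertex if $\mathrm{Chi}(v)$ contains at least two distinct vertices; $|v|$ is the unique $k\in\mathbb{N}_0$ with $\mathrm{par}^k(v)=\mathrm{root}$. Put $\lambda_{\mathrm{root}|v}=\prod_{j=0}^{|v|-1}\lambda_{\mathrm{par}^j(v)}$ (equal to $1$ if $v=\mathrm{root}$). $\ell^2(\boldsymbol{\beta})$ is the Hilbert space of all $f:V\to\mathbb{C}$ with $\|f\|_{\boldsymbol\beta}^2=\sum_{v\in V}|f(v)|^2\beta_v<\infty$, with $\langle f,g\rangle_{\boldsymbol\beta}=\sum_{v\in V} f(v)\overline{g(v)}\beta_v$. $\mathcal{T}_{\boldsymbol\beta}$ denotes the pair $(\mathcal{T},\boldsymbol\beta)$. The weighted shift $S_{\boldsymbol{\lambda}}$ on $\mathcal{T}_{\boldsymbol\beta}$ is given by $(S_{\boldsymbol\lambda}f)(v)=\lambda_v f(\mathrm{par}(v))$ for $v\in V^\circ$, $(S_{\boldsymbol\lambda}f)(\mathrm{root})=0$,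 on the domain of all $f\in\ell^2(\boldsymbol\beta)$ for which the resulting function lies in $\ell^2(\boldsymbol\beta)$; the condition $\sup_{u}\sum_{v\in\mathrm{Chi}(u)}|\lambda_v|^2\beta_v/\beta_u<\infty$ is equivalent to $S_{\boldsymbol\lambda}$ being bounded on $\ell^2(\boldsymbol\beta)$. The adjoint is taken with respect to $\langle\cdot,\cdot\rangle_{\boldsymbol\beta}$. A path in $\mathcal{T}$ is a subgraph $\mathscr{P}$ of $\mathcal{T}$ which is itself a directed tree, contains $\mathrm{root}$, and in which every vertex has exactly one child (with respect to $\mathscr{P}$). $\mathscr{P}(\mathcal{T})$ denotes the collection of all paths in $\mathcal{T}$. For a path $\mathscr{P}$ put $$r_2^{\mathscr{P}}(S_{\boldsymbol\lambda})=\lim_{n\to\infty}\inf\Big\{\big(\sqrt{\beta_v}\,\lambda_{\mathrm{root}|v}\big)^{1/|v|}: v\in\mathscr{P},\ |v|\ge n\Big\},$$ and $r_2^+(S_{\boldsymbol\lambda})=\sup\{r_2^{\mathscr{P}}(S_{\boldsymbol\lambda}):\mathscr{P}\in\mathscr{P}(\mathcal{T})\}$. *)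

(* Defs.v *)
(* MathComp / MathComp-Analysis; complex numbers are R[i] over R : realType. *)
From HB Require Import structures.
From mathcomp Require Import all_boot all_order all_algebra.
From mathcomp Require Import all_classical all_reals all_analysis.
From mathcomp Require Import complex.
From mathcomp Require summability.
Import Order.TTheory GRing.Theory Num.Theory.
Import numFieldNormedType.Exports.

Set Implicit Arguments.
Unset Strict Implicit.
Unset Printing Implicit Defensive.

Local Open Scope classical_set_scope.
Local Open Scope ring_scope.
Local Open Scope complex_scope.

(* The vertices form a subset of an ambient type, so that a subgraph is again
   a digraph over the same type. *)
Record digraph (V : Type) := Digraph { vertices : set V; edge : rel V }.

Section Trees.
Variable V : choiceType.
Implicit Types (T P : digraph V) (u v : V).

Definition wf_digraph T : Prop :=
  vertices T !=set0 /\
  forall u v, edge T u v -> [/\ vertices T u, vertices T v & u <> v].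

Definition connected_digraph T : Prop :=
  forall u v, vertices T u -> vertices T v ->
    exists p : seq V,
      path (fun x y => edge T x y || edge T y x) u p /\ last u p = v.

Definition circuit T (c : seq V) : Prop :=
  [/\ (1 < size c)%N, uniq c & cycle (edge T) c].

(* Here a root is a vertex without a parent; every other vertex must have
   exactly one. *)
Definition directed_tree T : Prop :=
  [/\ wf_digraph T, connected_digraph T, forall c, ~ circuit T c
    & forall v, vertices T v -> (exists u, edge T u v) ->
        exists! u, edge T u v].

Definition rooted_tree T (root : V) : Prop :=
  directed_tree T /\
  forall v, vertices T v /\ (~ exists u, edge T u v) <-> v = root.

Definition Chi T u : set V := [set v | edge T u v].

Definition leafless T : Prop := forall u, vertices T u -> Chi T u !=set0.

Definition branching T v : Prop :=
  exists w1 w2, [/\ Chi T v w1, Chi T v w2 & w1 <> w2].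

(* par is only meaningful at a vertex having a parent; elsewhere, in
   particular at the root, it is the identity. *)
Definition par T v : V := xget v [set u | edge T u v].

(* Since [par T root = root] by convention, |v| is the first k with
   par^k v = root, i.e. the only one for which no parent of the root is
   taken. *)
Definition depth T (root v : V) : nat :=
  xget 0%N [set k | iter k (par T) v = root /\
                    forall j, (j < k)%N -> iter j (par T) v <> root].

Definition subgraph P T : Prop :=
  vertices P `<=` vertices T /\ forall u v, edge P u v -> edge T u v.

Definition tree_path T (root : V) P : Prop :=
  [/\ subgraph P T, directed_tree P, vertices P root
    & forall u, vertices P u -> exists! v, Chi P u v].

End Trees.

Section WeightedSpace.
Variables (R : realType) (V : choiceType) (beta : V -> R).
Implicit Types f g : V -> R[i].

Definition l2 f : Prop :=
  (\esum_(v in [set: V]) (Normc.normc (f v) ^+ 2 * beta v)%:E < +oo)%E.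

(* Unconditional sum: limit of the partial sums along the finite subsets of
   V. The alias R[i]^o carries the normed space structure of R[i] over
   itself. *)
Definition inner f g : R[i] :=
  summability.sum (fun v => f v * conjc (g v) * (beta v)%:C : R[i]^o).

(* A (possibly unbounded) operator in l2 is given by its graph. *)
Definition operator := (V -> R[i]) -> (V -> R[i]) -> Prop.

(* For a densely defined A this relation is the graph of the adjoint A^*. *)
Definition adjoint (A : operator) : operator := fun g h =>
  [/\ l2 g, l2 h & forall f k, A f k -> inner k g = inner f h].

Definition point_spectrum (A : operator) : set R[i] :=
  [set z | exists2 f, f <> (fun=> 0) & A f (fun v => z * f v)].

End WeightedSpace.

Section WeightedShift.
Variables (R : realType) (V : choiceType) (T : digraph V) (root : V).
Variables (beta lambda : V -> R).

(* The weights are indexed by the vertices other than the root: the value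
   [lambda root] is never used. *)
Definition shift_fun (f : V -> R[i]) (v : V) : R[i] :=
  if v == root then 0 else (lambda v)%:C * f (par T v).

Definition weighted_shift : operator R V := fun f g =>
  [/\ l2 beta f, l2 beta g & g = shift_fun f].

Definition lambda_root (v : V) : R :=
  \prod_(j < depth T root v) lambda (iter j (par T) v).

(* At v = root the exponent 1/|v| is read as 0^-1 = 0; this only affects
   the term n = 0 of the limit. *)
Definition r2_path (P : digraph V) : \bar R :=
  limn (fun n : nat => ereal_inf
    [set ((Num.sqrt (beta v) * lambda_root v)
            `^ ((depth T root v)%:R^-1))%:E
      | v in [set v | vertices P v /\ (n <= depth T root v)%N]]).

Definition r2_plus : \bar R :=
  ereal_sup [set x | exists2 P, tree_path T root P & x = r2_path P].

End WeightedShift.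

(* Main.v *)
(* Let S^* f = z f with f <> 0 and z <> 0. Testing the equation against the unit
   masses gives sum_(v in Chi u) lambda_v beta_v f(v) = z beta_u f(u), so a
   vertex with f(u) <> 0 has a child with the same property, and there is a ray
   from the root along which f is eventually nonzero. Past the last branching
   vertex on this ray all lambda_v are 1: then lambda_(root|v) is constant and
   |f(v)| beta_v is multiplied by |z| at every step. Since |f(v)|^2 beta_v is
   bounded, sqrt(beta_v) >= K |z|^|v| for some K > 0, and taking |v|-th roots
   gives r_2 >= |z| along the ray. *)
Require Import Defs.
From HB Require Import structures.
From mathcomp Require Import all_boot all_order all_algebra.
From mathcomp Require Import all_classical all_reals all_analysis.
From mathcomp Require Import finmap complex.
From mathcomp Require Import lra.
Import Order.TTheory GRing.Theory Num.Theory.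
Import numFieldNormedType.Exports.

Set Implicit Arguments.
Unset Strict Implicit.
Unset Printing Implicit Defensive.

Local Open Scope classical_set_scope.
Local Open Scope ring_scope.
Local Open Scope complex_scope.

(** * Infinite rays from the root and the paths they trace *)

Section Rays.
Variables (V : choiceType) (T : digraph V) (root : V).
Hypothesis vertT : vertices T = [set: V].
Hypothesis treeT : rooted_tree T root.
Implicit Types (u v w : V) (s : nat -> V).

Lemma edge_parent_uniq u u' v : edge T u v -> edge T u' v -> u = u'.
Proof.
move=> uv u'v; have [[_ _ _ par_uniq] _] := treeT.
have [|w [_ w_uniq]] := par_uniq v _ (ex_intro _ u uv); first by rewrite vertT.
by rewrite -(w_uniq _ uv) -(w_uniq _ u'v).
Qed.

Lemma par_edge u v : edge T u v -> par T v = u.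
Proof.
by move=> uv; rewrite /par; apply: xget_unique => // w /edge_parent_uniq; exact.
Qed.

Lemma edge_neq_root u v : edge T u v -> v <> root.
Proof.
have [_ rootP] := treeT.
by move=> uv /rootP[_ noparent]; apply: noparent; exists u.
Qed.

Lemma edge_par v : v <> root -> edge T (par T v) v.
Proof.
have [_ rootP] := treeT => v_root; apply: contrapT => no_edge.
apply: v_root; apply/rootP; split=> [|[u uv]]; first by rewrite vertT.
by apply: no_edge; rewrite (par_edge uv).
Qed.

(** Connectedness gives only an undirected walk. While it is followed, a directed path from the root
    is maintained: a forward edge extends it, and a backward edge must retrace its last edge because
    parents are unique. *)
Lemma path_from_root v : exists2 p, path (edge T) root p & last root p = v.
Proof.
have [[_ connT _ _] _] := treeT.
have [||q [+ <-]] := connT root v; rewrite ?vertT//.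
have : exists2 p, path (edge T) root p & last root p = root by exists [::].
elim: q {3 4 7}root => [|y q IHq] x // [p p_path p_last] /= /andP[xy q_path].
apply: IHq q_path; case/orP: xy => [xy|yx].
  by exists (rcons p y); rewrite ?last_rcons// rcons_path p_path p_last.
(* If the path is empty, the backward edge would enter the root, which is impossible. *)
case/lastP: p p_path p_last => [_ /= x_root|p x'].
  by have := edge_neq_root yx; rewrite -x_root.
rewrite rcons_path last_rcons => /andP[p_path px'] x'x.
by exists p => //; apply: edge_parent_uniq px' _; rewrite x'x.
Qed.

Definition ray s := s 0%N = root /\ forall n, edge T (s n) (s n.+1).

(** The path from the root to [u] is continued by choosing children in [Q] forever. Later [Q] is the
    set where the eigenvector does not vanish, or the set of all vertices when the eigenvalue is
    0. *)
Lemma ray_extension (Q : set V) u :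
    (forall v, Q v -> exists2 w, edge T v w & Q w) -> Q u ->
  exists2 s, ray s & \forall n \near \oo, Q (s n).
Proof.
move=> Q_child Qu; have [p p_path p_last] := path_from_root u.
(* Outside [Q] the chosen successor is a dummy; the iteration started at [u] never leaves [Q]. *)
have /choice[next nextP] : forall v, exists w, Q v -> edge T v w /\ Q w.
  move=> v; have [/Q_child[w vw Qw]|nQv] := pselect (Q v); first by exists w.
  by exists v.
(* Both formulas give [u] at index [size p], so the two pieces join. *)
pose s n := if (n <= size p)%N then nth root (root :: p) n
            else iter (n - size p) next u.
have s_tail k : s (size p + k)%N = iter k next u.
  rewrite /s; case: k => [|k].
    by rewrite addn0 leqnn /= -last_nth.
  by rewrite addnS ltnNge leq_addr /= -addnS addKn.
have Qs k : Q (iter k next u) by elim: k => //= k /nextP[].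
exists s; first split=> [|n]; first by rewrite /s.
  have [n_lt|p_le] := ltnP n (size p).
    by rewrite /s n_lt (ltnW n_lt); exact: (pathP root p_path).
  by rewrite -(subnKC p_le) -addnS !s_tail; exact: (nextP _ (Qs _)).1.
exists (size p) => // n /= p_le.
by rewrite -(subnKC p_le) s_tail.
Qed.

Section Ray.
Variable s : nat -> V.
Hypothesis ray_s : ray s.

Lemma iter_par_ray n k : iter k (par T) (s (k + n)%N) = s n.
Proof. by elim: k => // k IHk; rewrite iterSr addSn (par_edge (ray_s.2 _)). Qed.

(** Climbing from [s n] follows the ray backwards, and every vertex met before step [n] is the end
    of an edge, hence not the root. *)
Lemma depth_ray n : depth T root (s n) = n.
Proof.
have iter_root : iter n (par T) (s n) = root.
  by rewrite -[in s n](addn0 n) iter_par_ray ray_s.1.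
have iter_lt j : (j < n)%N -> iter j (par T) (s n) <> root.
  move=> jn; rewrite -(subnKC (ltnW jn)) iter_par_ray.
  rewrite -(ltn_predK (_ : 0 < n - j)%N) ?subn_gt0//.
  exact: edge_neq_root (ray_s.2 _).
apply: xget_unique; first by split.
move=> k [k_root k_lt]; have [/iter_lt //|/k_lt //|//] := ltngtP k n.
Qed.

Lemma ray_inj : injective s.
Proof. by move=> m n smn; rewrite -(depth_ray m) smn depth_ray. Qed.

Definition ray_digraph : digraph V :=
  Digraph (range s) (fun u v => `[< exists n, u = s n /\ v = s n.+1 >]).

Lemma ray_digraphE u v :
  edge ray_digraph u v <-> exists n, u = s n /\ v = s n.+1.
Proof. by split=> /asboolP. Qed.

Lemma ray_digraph_connected : connected_digraph ray_digraph.
Proof.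
pose e x y := edge ray_digraph x y || edge ray_digraph y x.
(* Walks in both directions are built together, which covers either order of the two indices. *)
suff up m k : exists p, (path e (s m) p /\ last (s m) p = s (m + k)%N) /\
    exists q, path e (s (m + k)%N) q /\ last (s (m + k)%N) q = s m.
  move=> u v [m _ <-] [n _ <-]; have [mn|nm] := leqP m n.
    by have [p [+ _]] := up m (n - m)%N; rewrite subnKC// => ?; exists p.
  by have [_ [_ +]] := up n (m - n)%N; rewrite subnKC// ltnW.
elim: k => [|k [p [[p_path p_last] [q [q_path q_last]]]]].
  by rewrite addn0; exists [::]; split=> //; exists [::].
have step : edge ray_digraph (s (m + k)%N) (s (m + k.+1)%N).
  by apply/ray_digraphE; exists (m + k)%N; rewrite addnS.
exists (rcons p (s (m + k.+1)%N)); split.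
  by rewrite last_rcons rcons_path p_path p_last /e step.
by exists (s (m + k)%N :: q); split=> //=; rewrite q_path /e step orbT.
Qed.

(** Absence of circuits and uniqueness of parents pass to subgraphs; injectivity of the ray makes
    the child unique. *)
Lemma ray_tree_path : tree_path T root ray_digraph.
Proof.
have [[[_ wfT] _ acyclic _] _] := treeT.
have sub u v : edge ray_digraph u v -> edge T u v.
  by move=> /ray_digraphE[n [-> ->]]; exact: ray_s.2.
split.
- by split=> // v _; rewrite vertT.
- split.
  + split=> [|u v uv]; first by exists (s 0%N), 0%N.
    have [_ _ u_neq_v] := wfT _ _ (sub _ _ uv).
    by move: uv u_neq_v => /ray_digraphE[n [-> ->]]; split=> //=; [exists n|exists n.+1].
  + exact: ray_digraph_connected.
  + move=> c [c_size c_uniq c_cycle]; apply: (acyclic c); split=> //.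
    exact: sub_cycle c_cycle.
  + move=> v _ [u uv]; exists u; split=> // w wv.
    exact: edge_parent_uniq (sub _ _ uv) (sub _ _ wv).
- by rewrite -ray_s.1; exists 0%N.
- move=> _ [n _ <-]; exists (s n.+1); split.
    by apply/ray_digraphE; exists n.
  by move=> v /ray_digraphE[m [/ray_inj -> ->]].
Qed.

(** An injective ray meets the finite branching set at finitely many indices; past the largest of
    them, a child other than the next vertex of the ray would make [s n] branching. *)
Lemma ray_eventually_nonbranching : finite_set [set v | branching T v] ->
  \forall n \near \oo, Chi T (s n) = [set s n.+1].
Proof.
move=> fin_branching.
have : finite_set (s @^-1` [set v | branching T v]).
  by apply: finite_preimage => // m n _ _; exact: ray_inj.
move=> /finite_fsetP[/= B B_branching].
exists (\max_(n <- finmap.enum_fset B) n).+1 => // n /= B_n; apply/seteqP; split=> [v sn_v|v ->].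
  apply: contrapT => v_neq; suff : n \in finmap.enum_fset B.
    by move=> nB; have := @leq_bigmax_seq _ _ xpredT id n nB isT; rewrite leqNgt B_n.
  have : (s @^-1` [set v | branching T v]) n.
    by exists v, (s n.+1); split=> //; exact: ray_s.2.
  by rewrite B_branching.
exact: ray_s.2.
Qed.

End Ray.
End Rays.

(** * Unconditional sums, norm bounds and comparison of powers *)

Lemma sum_supp1 (R : realType) (I : choiceType) (x : I -> R[i]^o) (i : I) :
  (forall j, j <> i -> x j = 0) -> summability.sum x = x i.
Proof.
move=> x0; have hR : hausdorff_space R[i]^o by exact: norm_hausdorff.
have FF := @summability.totally_filter I.
apply: (cvg_lim hR).
(* Every finite set containing [i] already has partial sum [x i]. *)
apply: cvg_near_cst; exists (finmap.fset1 i) => // A /=.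
rewrite finmap.fsub1set => iA; rewrite /summability.partial_sum.
rewrite (bigD1 (finmap.FSetSub iA)) //= big1 ?addr0// => j j_neq; apply: x0 => ji.
by move/eqP: j_neq; apply; apply: val_inj.
Qed.

Lemma inner_supp1 (R : realType) (V : choiceType) (beta : V -> R)
    (f g : V -> R[i]) (v : V) :
    (forall w, w <> v -> f w * conjc (g w) = 0) ->
  inner beta f g = f v * conjc (g v) * (beta v)%:C.
Proof. by move=> fg0; apply: sum_supp1 => w /fg0 ->; rewrite mul0r. Qed.

Lemma normcJC (R : rcfType) (x : R[i]) :
  Normc.normc (conjc x) = Normc.normc x.
Proof. by case: x => a b /=; rewrite sqrrN. Qed.

Lemma normc_ge0 (R : rcfType) (x : R[i]) : 0 <= Normc.normc x.
Proof. by case: x => a b; exact: sqrtr_ge0. Qed.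

Lemma normc_real (R : rcfType) (a : R) : Normc.normc a%:C = `|a|.
Proof. by rewrite /= expr0n addr0 sqrtr_sqr. Qed.

(** Each term of a nonnegative sum is at most the total; 1 is added to make the bound positive even
    for a vanishing [f]. *)
Lemma l2_bounded (R : realType) (V : choiceType) (beta : V -> R) (f : V -> R[i]) :
  (forall v, 0 < beta v) -> l2 beta f ->
  exists2 M : R, 0 < M & forall v, Normc.normc (f v) ^+ 2 * beta v <= M.
Proof.
move=> beta_gt0 f_l2.
pose a v := (Normc.normc (f v) ^+ 2 * beta v)%:E.
have a_ge0 v : (0 <= a v)%E by rewrite lee_fin mulr_ge0 ?sqr_ge0 ?ltW.
have s_fin : (\esum_(v in [set: V]) a v)%E \is a fin_num.
  by rewrite ge0_fin_numE ?esum_ge0.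
exists (fine (\esum_(v in [set: V]) a v)%E + 1) => [|v].
  by rewrite ltr_wpDl// fine_ge0// esum_ge0.
rewrite ler_wpDr// -lee_fin fineK//; apply: esum_ge; exists [set v].
  by split=> //; exact: finite_set1.
by rewrite fsbig_set1.
Qed.

Lemma powR_inv_ge (R : realType) (c x : R) (n : nat) :
  0 <= c -> (0 < n)%N -> c ^+ n <= x -> c <= x `^ n%:R^-1.
Proof.
move=> c_ge0 n_gt0 cnx; have cn_ge0 : 0 <= c ^+ n by rewrite exprn_ge0.
have -> : c = (c ^+ n) `^ n%:R^-1.
  by rewrite -powR_mulrn// -powRrM mulfV ?powRr1// pnatr_eq0 -lt0n.
by rewrite ge0_ler_powR// ?invr_ge0// nnegrE (le_trans cn_ge0).
Qed.

(** As [(c / r) ^+ n] tends to 0, a strictly smaller base absorbs the constant [K]. *)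
Lemma exprn_eventually_le (R : realType) (c r K : R) : 0 <= c < r -> 0 < K ->
  \forall n \near \oo, c ^+ n <= K * r ^+ n.
Proof.
move=> /andP[c_ge0 cr] K_gt0; have r_gt0 : 0 < r := le_lt_trans c_ge0 cr.
have /cvg_expr/cvgrPdist_le/(_ _ K_gt0) : `|c / r| < 1.
  by rewrite ger0_norm ?divr_ge0 ?(ltW r_gt0)// ltr_pdivrMr// mul1r.
apply: filterS => n; rewrite sub0r normrN normrX ger0_norm ?divr_ge0 ?(ltW r_gt0)//.
by rewrite expr_div_n ler_pdivrMr ?exprn_gt0.
Qed.

(** * Lower bounds for [r2_path] *)

Section RayLimit.
Variables (R : realType) (V : choiceType) (T : digraph V) (root : V).
Variables (beta lambda : V -> R).
Hypothesis vertT : vertices T = [set: V].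
Hypothesis treeT : rooted_tree T root.

(** The infima run over shrinking sets, so they are nondecreasing and their limit is a supremum;
    bounding a single infimum from below then suffices. *)
Lemma r2_path_cvg (P : digraph V) :
  exists2 u : (\bar R)^nat, r2_path T root beta lambda P = ereal_sup (range u) &
    forall n, u n = ereal_inf
    [set ((Num.sqrt (beta v) * lambda_root T root lambda v)
            `^ ((depth T root v)%:R^-1))%:E
      | v in [set v | vertices P v /\ (n <= depth T root v)%N]].
Proof.
eexists; last by move=> n; reflexivity.
apply: cvg_lim => //; apply: ereal_nondecreasing_cvgn => m n mn.
apply: ereal_inf_le_tmp; apply: image_subset => v /= [Pv nv]; split=> //.
exact: leq_trans nv.
Qed.

Lemma r2_path_ge0 (P : digraph V) : (0 <= r2_path T root beta lambda P)%E.
Proof.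
have [u -> uE] := r2_path_cvg P.
apply: (@le_trans _ _ (u 0%N)); last by apply: ereal_sup_ubound; exists 0%N.
by rewrite uE; apply: le_ereal_inf_tmp => _ [v _ <-]; rewrite lee_fin powR_ge0.
Qed.

(** Arguing with every [c < r] avoids taking roots of [K]: eventually [c ^+ n <= K * r ^+ n]. *)
Lemma r2_ray_ge (s : nat -> V) (K r : R) : ray T root s -> 0 < K -> 0 <= r ->
    (\forall n \near \oo,
       K * r ^+ n <= Num.sqrt (beta (s n)) * lambda_root T root lambda (s n)) ->
  (r%:E <= r2_path T root beta lambda (ray_digraph s))%E.
Proof.
move=> ray_s K_gt0 r_ge0 s_ge.
have r2_ge0 := r2_path_ge0 (ray_digraph s).
suff r2_ge c : 0 <= c < r ->
    (c%:E <= r2_path T root beta lambda (ray_digraph s))%E.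
  rewrite leNgt; apply/negP; move: r2_ge0 r2_ge.
  case: r2_path => // x; rewrite lee_fin lte_fin => x_ge0 r2_ge xr.
  (* If the limit [x] were below [r], the midpoint would be a violating [c]; it is nonnegative
     because [x] is. *)
  have := r2_ge ((x + r) / 2).
  by rewrite lee_fin !(midf_le, midf_lt)//; lra.
move=> cr; have [u -> uE] := r2_path_cvg (ray_digraph s).
have /andP[c_ge0 _] := cr.
have [N _ N_ge] : \forall n \near \oo,
    c ^+ n <= Num.sqrt (beta (s n)) * lambda_root T root lambda (s n).
  by apply: filterS2 (exprn_eventually_le cr K_gt0) s_ge => n; exact: le_trans.
(* Taking [N.+1] rather than [N] keeps all depths positive, so the convention for the exponent at
   the root does not interfere. *)
apply: (@le_trans _ _ (u N.+1)); last by apply: ereal_sup_ubound; exists N.+1.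
rewrite uE; apply: le_ereal_inf_tmp => _ [_ [[n _ <-] +] <-].
rewrite (depth_ray vertT treeT ray_s) => Nn; rewrite lee_fin.
by apply: powR_inv_ge => //; [exact: leq_trans Nn|apply: N_ge; exact: ltnW].
Qed.

Lemma lambda_root_ray (s : nat -> V) n : ray T root s ->
  lambda_root T root lambda (s n.+1) =
    lambda (s n.+1) * lambda_root T root lambda (s n).
Proof.
move=> ray_s; rewrite /lambda_root !(depth_ray vertT treeT ray_s) big_ord_recl.
congr (_ * _); apply: eq_bigr => j _.
by rewrite /= -iterS iterSr (par_edge vertT treeT (ray_s.2 n)).
Qed.

End RayLimit.

(** * The eigenvalue equation tested against unit masses *)

Section Eigenvector.
Variables (R : realType) (V : choiceType) (T : digraph V) (root : V).
Variables (beta lambda : V -> R).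
Hypothesis vertT : vertices T = [set: V].
Hypothesis treeT : rooted_tree T root.
Hypothesis beta_gt0 : forall v, 0 < beta v.
Hypothesis boundedT : (ereal_sup [set \esum_(v in Chi T u)
  (`|lambda v| ^+ 2 * (beta v / beta u))%:E | u in [set: V]] < +oo)%E.

Let S := weighted_shift T root beta lambda.
(** The mass is not normalised: its squared norm is [beta u]. *)
Definition delta u (v : V) : R[i] := if v == u then 1 else 0.

Lemma shift_delta u v :
  shift_fun T root lambda (delta u) v =
  if `[< edge T u v >] then (lambda v)%:C else 0.
Proof.
rewrite /shift_fun /delta; case: eqP => [->|v_root].
  by case: asboolP => // /(edge_neq_root treeT).
case: asboolP => [uv|nuv]; first by rewrite (par_edge vertT treeT uv) eqxx mulr1.
case: eqP => [uE|_]; last by rewrite mulr0.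
by case: nuv; rewrite -uE; exact: (edge_par vertT treeT).
Qed.

(** The squared norm of the image is [beta u] times the sum over children controlled by [boundedT],
    so [delta u] lies in the domain of the shift and may serve as a test function. *)
Lemma weighted_shift_delta u : S (delta u) (shift_fun T root lambda (delta u)).
Proof.
split=> //; rewrite /l2.
  rewrite (_ : (\esum_(v in _) _)%E = (\esum_(v in [set u]) (beta v)%:E)%E).
    by rewrite esum_set1 ?lee_fin ?ltW// ltry.
  rewrite [RHS]esum_mkcond; apply: eq_esum => v _; rewrite /delta.
  have [->|vu] := eqVneq v u.
    by rewrite mem_set// Normc.normc1 expr1n mul1r.
  by rewrite memNset ?Normc.normc0 ?expr0n ?mul0r//=; apply/eqP.
have fin_u : (\esum_(v in Chi T u) (`|lambda v| ^+ 2 * (beta v / beta u))%:E < +oo)%E.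
  by apply: le_lt_trans boundedT; apply: ereal_sup_ubound; exists u.
rewrite (_ : (\esum_(v in _) _)%E =
    (\esum_(v in Chi T u) (`|lambda v| ^+ 2 * beta v)%:E)%E); last first.
  rewrite [RHS]esum_mkcond; apply: eq_esum => v _; rewrite shift_delta.
  case: asboolP => uv; first by rewrite mem_set// normc_real.
  by rewrite memNset// Normc.normc0 expr0n mul0r.
apply: (@le_lt_trans _ _ ((beta u)%:E *
   \esum_(v in Chi T u) (`|lambda v| ^+ 2 * (beta v / beta u))%:E)%E).
  apply: ge_ereal_sup => _ [X [finX XChi] <-].
  rewrite (eq_fsbigr (fun v =>
    ((beta u)%:E * (`|lambda v| ^+ 2 * (beta v / beta u))%:E)%E)).
    rewrite -ge0_mule_fsumr => [|v].
      rewrite lee_pmul2l// ?lte_fin//; apply: esum_ge; exists X => //.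
    by rewrite lee_fin mulr_ge0 ?sqr_ge0 ?divr_ge0 ?ltW.
  move=> v _; rewrite -EFinM; congr EFin.
  by rewrite mulrCA (mulrC (beta u)) divfK// gt_eqF.
by rewrite lte_mul_pinfty// ?lee_fin ?ltW.
Qed.

Variables (f : V -> R[i]) (z : R[i]).
Hypothesis eigen_f : adjoint beta S f (fun v => z * f v).

(** The left side only involves the children of [u], so the adjoint relation ties [f u] to the
    values of [f] one level further from the root. *)
Lemma inner_delta_eigen u :
  inner beta (shift_fun T root lambda (delta u)) f = conjc (z * f u) * (beta u)%:C.
Proof.
have [_ _ adj_f] := eigen_f; rewrite (adj_f _ _ (weighted_shift_delta u)).
rewrite (@inner_supp1 _ _ _ _ _ u) => [|v /eqP/negPf vu].
  by rewrite /delta eqxx mul1r.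
by rewrite /delta vu mul0r.
Qed.

(** If [f] vanished at all children of [u], the left side of [inner_delta_eigen] would be 0 while
    its right side is not. *)
Lemma eigen_child u : z <> 0 -> f u <> 0 -> exists2 v, edge T u v & f v <> 0.
Proof.
move=> /eqP z0 /eqP fu0; apply: contrapT => no_child; have := inner_delta_eigen u.
have term0 v : shift_fun T root lambda (delta u) v * conjc (f v) = 0.
  rewrite shift_delta; case: asboolP => [uv|_]; last by rewrite mul0r.
  have [->|/eqP fv0] := eqVneq (f v) 0; first by rewrite conjc0 mulr0.
  by case: no_child; exists v.
(* All terms vanish, so [u] is an arbitrary choice of support point. *)
rewrite (@inner_supp1 _ _ _ _ _ u)// term0 mul0r => /esym/eqP.
by rewrite mulf_eq0 conjc_eq0 mulf_eq0 (negPf z0) (negPf fu0)/= fmorph_eq0 gt_eqF.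
Qed.

(** The inner product reduces to the term of the single child, and absolute values remove the
    conjugations. *)
Lemma eigen_only_child u v : Chi T u = [set v] ->
  `|lambda v| * Normc.normc (f v) * beta v =
  Normc.normc z * Normc.normc (f u) * beta u.
Proof.
move=> Chi_u; have := congr1 (@Normc.normc R) (inner_delta_eigen u).
have uv : edge T u v by have : Chi T u v by rewrite Chi_u.
rewrite (@inner_supp1 _ _ _ _ _ v) => [|w wv].
  rewrite shift_delta asboolT// !Normc.normcM !normcJC !Normc.normcM !normc_real.
  by rewrite (ger0_norm (ltW (beta_gt0 u))) (ger0_norm (ltW (beta_gt0 v))).
rewrite shift_delta; case: asboolP => [uw|_]; last by rewrite mul0r.
by have : Chi T u w by []; rewrite Chi_u.
Qed.

End Eigenvector.

(** * Growth of an eigenvector along a ray, and the bound on the eigenvalue *)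

Theorem proposition26 (R : realType) (V : choiceType) (T : digraph V)
    (root : V) (beta lambda : V -> R)
    (hV : ([set: V] #= [set: nat])%card)
    (hvert : vertices T = [set: V])
    (htree : rooted_tree T root)
    (hleaf : leafless T)
    (hbeta : forall v, 0 < beta v)
    (hlambda : forall v, v <> root -> 0 < lambda v)
    (hbounded : (ereal_sup [set \esum_(v in Chi T u)
                   (`|lambda v| ^+ 2 * (beta v / beta u))%:E | u in [set: V]]
                 < +oo)%E)
    (hsum : forall u, (\esum_(v in Chi T u) (lambda v)%:E = 1)%E)
    (hbranch : finite_set [set v | branching T v]) :
  point_spectrum (adjoint beta (weighted_shift T root beta lambda)) `<=`
  [set z : R[i] | ((Normc.normc z)%:E
                   <= r2_plus T root beta lambda)%E].
Proof.
move=> z [f f_neq0 eigen_f] /=.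
have ray_le s : ray T root s ->
    (r2_path T root beta lambda (ray_digraph s) <= r2_plus T root beta lambda)%E.
  move=> ray_s; apply: ereal_sup_ubound; exists (ray_digraph s) => //.
  exact: ray_tree_path ray_s.
have [z0|/eqP z_neq0] := eqVneq z 0.
  (* Even for [z = 0] a path must be exhibited, since a supremum over no paths would be [-oo];
     leaflessness provides one. *)
  have [s ray_s _] : exists2 s, ray T root s & \forall n \near \oo, setT (s n).
    apply: (@ray_extension _ _ _ hvert htree setT root) => // v _.
    by have [|w vw] := hleaf v; rewrite ?hvert//; exists w.
  rewrite z0 Normc.normc0; apply: le_trans (ray_le _ ray_s).
  exact: r2_path_ge0.
have [u fu0] : exists u, f u <> 0.
  apply: contrapT => /forallNP f0; apply: f_neq0; apply/funext => v.
  by have /contrapT := f0 v.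
have [s ray_s fs_neq0] : exists2 s, ray T root s & \forall n \near \oo, f (s n) <> 0.
  apply: (@ray_extension _ _ _ hvert htree [set v | f v <> 0] u) => // v.
  exact: (eigen_child hvert htree hbeta hbounded eigen_f).
apply: le_trans (ray_le _ ray_s).
have only_child := ray_eventually_nonbranching hvert htree ray_s hbranch.
have [N _ N_ge] : \forall n \near \oo, f (s n) <> 0 /\ Chi T (s n) = [set s n.+1].
  by apply: filterS2 fs_neq0 only_child.
(* The weights of the children of [s n] sum to 1, and there is only one child. *)
have lambda1 n : (N <= n)%N -> lambda (s n.+1) = 1.
  move=> Nn; have := hsum (s n); rewrite (N_ge _ Nn).2 esum_set1; first by case.
  by rewrite lee_fin ltW//; apply: hlambda; exact: edge_neq_root (ray_s.2 _).
set r := Normc.normc z; pose a n := Normc.normc (f (s n)) * beta (s n).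
have r_gt0 : 0 < r.
  by rewrite lt_neqAle normc_ge0 andbT eq_sym; apply/eqP => /Normc.eq0_normc.
have aS n : (N <= n)%N -> a n.+1 = r * a n.
  move=> Nn; have := eigen_only_child hvert htree hbeta hbounded eigen_f (N_ge _ Nn).2.
  by rewrite lambda1// normr1 mul1r -mulrA.
have aE k : a (N + k)%N = r ^+ k * a N.
  elim: k => [|k IHk]; first by rewrite addn0 mul1r.
  by rewrite addnS aS ?leq_addr// IHk mulrA exprS.
have lambda_rootE k : lambda_root T root lambda (s (N + k)%N) =
    lambda_root T root lambda (s N).
  elim: k => [|k IHk]; first by rewrite addn0.
  by rewrite addnS (lambda_root_ray _ hvert htree)// lambda1 ?leq_addr// mul1r.
have lambda_root_gt0 n : 0 < lambda_root T root lambda (s n).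
  elim: n => [|n IHn].
    by rewrite /lambda_root (depth_ray hvert htree ray_s) big_ord0.
  rewrite (lambda_root_ray _ hvert htree)// mulr_gt0//; apply: hlambda.
  exact: edge_neq_root (ray_s.2 _).
have [f_l2 _ _] := eigen_f; have [M M_gt0 M_ge] := l2_bounded hbeta f_l2.
(* The square of [a n] is a term of the squared norm of [f], at most [M], times [beta (s n)]. *)
have a_le n : a n <= Num.sqrt M * Num.sqrt (beta (s n)).
  have a_ge0 : 0 <= a n by rewrite mulr_ge0 ?normc_ge0 ?ltW.
  rewrite -sqrtrM ?(ltW M_gt0)// -[a n]ger0_norm// -sqrtr_sqr.
  rewrite ler_sqrt; last by rewrite mulr_ge0 ?ltW.
  by rewrite exprMn [beta _ ^+ 2]expr2 mulrA ler_pM2r.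
have aN_gt0 : 0 < a N.
  rewrite mulr_gt0// lt_neqAle normc_ge0 andbT eq_sym; apply/eqP => /Normc.eq0_normc.
  exact: (N_ge _ (leqnn N)).1.
(* The constant is chosen so that, for [n >= N], its product with [r ^+ n] is [a n / Num.sqrt M]
   times the eventual value of [lambda_root] along the ray. *)
apply: (@r2_ray_ge _ _ _ _ _ _ hvert htree s (a N / r ^+ N / Num.sqrt M *
  lambda_root T root lambda (s N))) => //.
- by rewrite mulr_gt0// !divr_gt0// ?exprn_gt0// sqrtr_gt0.
- exact: ltW.
exists N => // n /= Nn; rewrite -(subnKC Nn) lambda_rootE mulrAC.
rewrite ler_pM2r//; apply: le_trans (_ : a (N + (n - N))%N / Num.sqrt M <= _).
  rewrite aE exprD mulrAC ler_pM2r ?invr_gt0 ?sqrtr_gt0//.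
  by rewrite mulrA divfK ?gt_eqF ?exprn_gt0// mulrC.
by rewrite ler_pdivrMr ?sqrtr_gt0// mulrC a_le.
Qed.
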